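(* Let $\mathbb{K}=\mathbb{R}$ or $\mathbb{K}=\mathbb{C}$, let $W\in\mathbb{K}^{m\times n}$ have rank $r$, and let $W=U\Sigma V^*$ be any SVD of $W$ over $\mathbb{K}$. Let $\sigma_1>\sigma_2>\dots>\sigma_t>0$ be the pairwise distinct nonzero singular values of $W$, and let $s_i$ be the multiplicity of $\sigma_i$, that is, the dimension of the eigenspace of $WW^*$ for the eigenvalue $\sigma_i^2$. Then a matrix $X\in\mathbb{K}^{n\times m}$ satisfies $$XWW^*WX=W^*$$ if and only if there exist a block diagonal matrix $$D=\operatorname{diag}(X_1,\ldots,X_t,0,\ldots,0)\in\mathbb{K}^{m\times m},$$ where $X_i\in\mathbb{K}^{s_i\times s_i}$ and $X_i^2=I_{s_i}$ for $i=1,\ldots,t$, and a matrix $Y\in\mathbb{K}^{n\times m}$ such that $$X=V\Sigma^{+}DU^*+P_{\mathcal{N}(W)}\,Y\,P_{\mathcal{N}(W^* )}.$$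
   Context: $A^*$ denotes the conjugate transpose (transpose over $\mathbb{R}$) and $A^+$ the Moore--Penrose pseudoinverse of $A$. $\mathcal{N}(A)$ denotes the null space of $A$, and $P_{\mathcal{S}}$ denotes the orthogonal projection matrix onto a subspace $\mathcal{S}$. An SVD of $W\in\mathbb{K}^{m\times n}$ over $\mathbb{K}$ is a factorization $W=U\Sigma V^*$ with $U\in\mathbb{K}^{m\times m}$, $V\in\mathbb{K}^{n\times n}$ unitary (orthogonal if $\mathbb{K}=\mathbb{R}$) and $\Sigma\in\mathbb{R}^{m\times n}$ generalized diagonal with non-negative diagonal entries in decreasing (non-increasing) order. In $D$, the trailing zeros fill the lower right block of size $(m-r)\times(m-r)$, where $r=s_1+\dots+s_t=\operatorname{rank} W$. *)

(* Defs.v *)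
From HB Require Import structures.
From mathcomp Require Import all_boot all_order all_algebra.
From mathcomp Require Import complex.
From mathcomp Require Import boolp classical_sets reals.

Set Implicit Arguments.
Unset Strict Implicit.
Unset Printing Implicit Defensive.

Import Order.TTheory GRing.Theory Num.Theory.
Local Open Scope ring_scope.
Local Open Scope complex_scope.

(* The two admissible base fields, treated uniformly: [scalars R k] is R itself
   or R[i] according to k. *)
Variant scalar_kind := RealScalars | ComplexScalars.

Definition scalars (R : realType) (k : scalar_kind) : numFieldType :=
  match k with
  | RealScalars => R
  | ComplexScalars => R[i]
  end.

Definition conjs (R : realType) (k : scalar_kind) : scalars R k -> scalars R k :=
  match k with
  | RealScalars => id
  | ComplexScalars => @conjc R
  end.

Definition of_real (R : realType) (k : scalar_kind) : R -> scalars R k :=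
  match k with
  | RealScalars => id
  | ComplexScalars => real_complex R
  end.

Section Scalars.
Variables (R : realType) (k : scalar_kind).

Fact conjs_is_zmod_morphism : zmod_morphism (@conjs R k).
Proof. by case: k => // x y; exact: (rmorphB (@conjc R)). Qed.

Fact conjs_is_monoid_morphism : monoid_morphism (@conjs R k).
Proof.
case: k => //; split; first exact: (rmorph1 (@conjc R)).
by move=> x y; exact: (rmorphM (@conjc R)).
Qed.

HB.instance Definition _ := GRing.isZmodMorphism.Build
  (scalars R k) (scalars R k) (@conjs R k) conjs_is_zmod_morphism.
HB.instance Definition _ := GRing.isMonoidMorphism.Build
  (scalars R k) (scalars R k) (@conjs R k) conjs_is_monoid_morphism.

Fact of_real_is_zmod_morphism : zmod_morphism (@of_real R k).
Proof. by case: k => // x y; exact: (rmorphB (real_complex R)). Qed.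

Fact of_real_is_monoid_morphism : monoid_morphism (@of_real R k).
Proof.
case: k => //; split; first exact: (rmorph1 (real_complex R)).
by move=> x y; exact: (rmorphM (real_complex R)).
Qed.

HB.instance Definition _ := GRing.isZmodMorphism.Build
  R (scalars R k) (@of_real R k) of_real_is_zmod_morphism.
HB.instance Definition _ := GRing.isMonoidMorphism.Build
  R (scalars R k) (@of_real R k) of_real_is_monoid_morphism.

Lemma conjsK : involutive (@conjs R k).
Proof. by case: k => // x; exact: conjcK. Qed.

Lemma conjs_mul_ge0 (x : scalars R k) : 0 <= conjs x * x.
Proof.
case: k x => [x|x] /=; first by rewrite -expr2 sqr_ge0.
by rewrite mulrC; exact: (mul_conjC_ge0 (x : R[i])).
Qed.

End Scalars.

Section Matrices.
Variables (R : realType) (k : scalar_kind).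
Local Notation K := (scalars R k).

Definition adjoint m n (A : 'M[K]_(m, n)) : 'M[K]_(n, m) :=
  (map_mx (@conjs R k) A)^T.

Definition unitary n (U : 'M[K]_n) : Prop := adjoint U *m U = 1%:M.

Definition real_mx m n (S : 'M[R]_(m, n)) : 'M[K]_(m, n) :=
  map_mx (@of_real R k) S.

Definition is_pinv m n (A : 'M[K]_(m, n)) (B : 'M[K]_(n, m)) : Prop :=
  [/\ A *m B *m A = A, B *m A *m B = B,
      adjoint (A *m B) = A *m B & adjoint (B *m A) = B *m A].

(* Total by choice; [pinvP] and [pinv_unique] below show that it is the unique
   solution of the Penrose equations. *)
Definition pinv m n (A : 'M[K]_(m, n)) : 'M[K]_(n, m) :=
  xget 0 [set B | is_pinv A B].

Definition nullspace m n (A : 'M[K]_(m, n)) : {vspace 'cV[K]_n} :=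
  lker (linfun (mulmx A : 'cV[K]_n -> 'cV[K]_m)).

Definition is_orthproj n (S : {vspace 'cV[K]_n}) (P : 'M[K]_n) : Prop :=
  forall x : 'cV[K]_n,
    P *m x \in S /\ forall y, y \in S -> adjoint y *m (x - P *m x) = 0.

(* Total by choice; see [orthprojP] and [orthproj_unique]. *)
Definition orthproj n (S : {vspace 'cV[K]_n}) : 'M[K]_n :=
  xget 0 [set P | is_orthproj S P].

Definition is_svd m n (W : 'M[K]_(m, n))
    (U : 'M[K]_m) (S : 'M[R]_(m, n)) (V : 'M[K]_n) : Prop :=
  [/\ unitary U, unitary V, W = U *m real_mx S *m adjoint V &
   [/\ forall (i : 'I_m) (j : 'I_n), i != j :> nat -> S i j = 0,
       forall (i : 'I_m) (j : 'I_n), i = j :> nat -> 0 <= S i j &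
       forall (i1 i2 : 'I_m) (j1 j2 : 'I_n),
         i1 = j1 :> nat -> i2 = j2 :> nat -> (i1 <= i2)%N ->
         S i2 j2 <= S i1 j1]].

Definition singular_value m n (W : 'M[K]_(m, n)) (x : R) : Prop :=
  exists U S V, is_svd W U S V /\
    exists (i : 'I_m) (j : 'I_n), i = j :> nat /\ S i j = x.

Definition sv_multiplicity m n (W : 'M[K]_(m, n)) (x : R) : nat :=
  \dim (passmx.leigenspace
          (linfun (mulmx (W *m adjoint W) : 'cV[K]_m -> 'cV[K]_m))
          (of_real k (x ^+ 2))).

(* D = diag(X_0, ..., X_(t-1), 0) with a q x q trailing zero block.  The cast
   only identifies the index types 'I_(s_0 + ... + s_(t-1) + q) and 'I_m. *)
Definition is_block_diag m t (s : 'I_t -> nat) (q : nat)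
    (X : forall i, 'M[K]_(s i)) (D : 'M[K]_m) : Prop :=
  exists e : (\sum_i s i + q)%N = m,
    D = castmx (e, e) (block_mx (\mxdiag_i X i) 0 0 (0 : 'M[K]_q)).

Lemma adjointM m n p (A : 'M[K]_(m, n)) (B : 'M[K]_(n, p)) :
  adjoint (A *m B) = adjoint B *m adjoint A.
Proof. by rewrite /adjoint map_mxM trmx_mul. Qed.

Lemma adjointK m n (A : 'M[K]_(m, n)) : adjoint (adjoint A) = A.
Proof. by apply/matrixP=> i j; rewrite !mxE conjsK. Qed.

Lemma adjoint_mul_eq0 m n (A : 'M[K]_(m, n)) : adjoint A *m A = 0 -> A = 0.
Proof.
move=> A0; apply/matrixP=> i j; rewrite mxE.
have /eqP := congr1 (fun M : 'M_n => M j j) A0.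
rewrite !mxE psumr_eq0; last by move=> l _; rewrite !mxE conjs_mul_ge0.
move=> /allP /(_ i (mem_index_enum _)) /=; rewrite !mxE mulf_eq0 fmorph_eq0.
by rewrite orbb => /eqP.
Qed.

Lemma adjoint_mul_unit m n (A : 'M[K]_(m, n)) :
  row_full A -> adjoint A *m A \in unitmx.
Proof.
move=> fA; rewrite -row_free_unit -kermx_eq0; apply/eqP.
set Q := kermx _; have Q0 : Q *m (adjoint A *m A) = 0 by exact: mulmx_ker.
have AQ0 : A *m adjoint Q = 0.
  apply: adjoint_mul_eq0.
  by rewrite adjointM adjointK -mulmxA (mulmxA _ A) (mulmxA Q) Q0 mul0mx.
have [B BA] := row_fullP fA.
by rewrite -[Q]adjointK -[adjoint Q]mul1mx -BA -mulmxA AQ0 mulmx0 /adjoint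
  map_mx0 trmx0.
Qed.

Lemma pinvP m n (A : 'M[K]_(m, n)) : is_pinv A (pinv A).
Proof.
apply: xgetPex.
have := mulmx_base A; have := col_base_full A; have := row_base_free A.
move: (\rank A) (col_base A) (row_base A) => q C B fB fC AE.
have uC := adjoint_mul_unit fC.
have fB' : row_full (adjoint B) by rewrite /row_full mxrank_tr mxrank_map.
have := adjoint_mul_unit fB'; rewrite adjointK => uB.
set G := B *m _ in uB; set H := _ *m C in uC.
exists (adjoint B *m invmx G *m invmx H *m adjoint C).
have AX : A *m (adjoint B *m invmx G *m invmx H *m adjoint C)
          = C *m invmx H *m adjoint C.
  by rewrite -{1}AE -!mulmxA (mulmxA B) -/G (mulmxA G) mulmxV ?mul1mx.
have XA : adjoint B *m invmx G *m invmx H *m adjoint C *m A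
          = adjoint B *m invmx G *m B.
  by rewrite -{1}AE -!mulmxA (mulmxA (adjoint C)) -/H (mulmxA (invmx H))
    mulVmx ?mul1mx.
have aI p (M : 'M[K]_p) : M \in unitmx -> adjoint M = M ->
    adjoint (invmx M) = invmx M.
  by move=> uM aM; rewrite /adjoint map_invmx trmx_inv -/(adjoint M) aM.
have aG : adjoint (invmx G) = invmx G by rewrite aI // adjointM adjointK.
have aH : adjoint (invmx H) = invmx H by rewrite aI // adjointM adjointK.
split; rewrite ?AX ?XA.
- by rewrite -AE -!mulmxA (mulmxA (adjoint C)) -/H (mulmxA (invmx H))
    mulVmx ?mul1mx.
- by rewrite -!mulmxA (mulmxA B) -/G (mulmxA (invmx G) G) mulVmx ?mul1mx.
- by rewrite !adjointM adjointK aH mulmxA.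
- by rewrite !adjointM adjointK aG mulmxA.
Qed.

Lemma pinv_unique m n (A : 'M[K]_(m, n)) (B : 'M[K]_(n, m)) :
  is_pinv A B -> B = pinv A.
Proof.
case: (pinvP A); set C := pinv A => c1 c2 c3 c4 [b1 b2 b3 b4].
have AB : A *m B = A *m C.
  by rewrite -b3 -{1}c1 -mulmxA adjointM b3 c3 mulmxA b1.
have BA : B *m A = C *m A.
  by rewrite -b4 -{1}c1 2!mulmxA -mulmxA adjointM b4 c4 -mulmxA (mulmxA A) b1.
by rewrite -b2 BA -mulmxA AB mulmxA c2.
Qed.

Lemma orthprojP n (S : {vspace 'cV[K]_n}) : is_orthproj S (orthproj S).
Proof.
apply: xgetPex.
pose B : 'M[K]_(n, \dim S) := \matrix_(i, j) (vbasis S)`_j i 0.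
have BE (c : 'cV_(\dim S)) : B *m c = \sum_j c j 0 *: (vbasis S)`_j.
  apply/matrixP=> i j; rewrite mxE summxE; apply: eq_bigr => l _.
  by rewrite !mxE mulrC (ord1 j).
exists (B *m pinv B) => x; split.
  rewrite -mulmxA BE; apply: memv_suml => j _; apply: memvZ.
  by apply: vbasis_mem; rewrite mem_nth ?size_tuple.
move=> y /coord_vbasis yE.
have -> : y = B *m \col_j coord (vbasis S) j y.
  by rewrite BE {1}yE; apply: eq_bigr => j _; rewrite mxE.
have [B1 _ B3 _] := pinvP B.
rewrite adjointM -mulmxA mulmxBr (mulmxA (adjoint B)) -[in X in _ - X]B3.
by rewrite -adjointM B1 subrr mulmx0.
Qed.

Lemma orthproj_unique n (S : {vspace 'cV[K]_n}) (P : 'M[K]_n) :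
  is_orthproj S P -> P = orthproj S.
Proof.
move=> hP; have hQ := orthprojP S; set Q := orthproj S in hQ *.
suff PQ (x : 'cV_n) : P *m x = Q *m x.
  apply/matrixP=> i j; have := congr1 (fun v : 'cV_n => v i 0) (PQ (delta_mx j 0)).
  by rewrite -!colE !mxE.
have [Px oP] := hP x; have [Qx oQ] := hQ x.
have dS : P *m x - Q *m x \in S by rewrite memvB.
apply/eqP; rewrite -subr_eq0; apply/eqP/adjoint_mul_eq0.
have {2}-> : P *m x - Q *m x = (x - Q *m x) - (x - P *m x).
  by rewrite opprB [RHS]addrC addrA subrK.
by rewrite mulmxBr oQ // oP // subrr.
Qed.

End Matrices.

(* Main.v *)
Require Import Defs.
From mathcomp Require Import all_boot all_order all_algebra.
From mathcomp Require Import reals.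

Import Order.TTheory GRing.Theory Num.Theory.
Local Open Scope ring_scope.

Set Implicit Arguments.
Unset Strict Implicit.
Unset Printing Implicit Defensive.

(** Put M = W X. The equation X W W^* W X = W^* says first of all that X is
    adapted to the kernels of W and W^*: whatever W^* kills, M kills as well
    ([solution_kernel]), and dually X W has no component in the null space of W
    ([solution_cokernel]). Hence X splits as W^+ M plus an arbitrary block from
    the null space of W^* to that of W ([solution_form]), and what is left of the equation is
    M W W^* M = W W^*. Conversely this last equation suffices
    ([form_solution]).

    In the basis of left singular vectors, M becomes D = U^* M U and W W^*
    becomes the real nonnegative diagonal matrix T with entries the squared
    singular values, so D T D = T. Now (D T)^2 = T^2, so D T commutes with T^2;
    squaring is injective on nonnegative reals, so D T, and then D, only has
    entries between positions with equal diagonal value of T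
    ([diag_sandwich_support]). With the kernel condition, which removes the
    columns where T vanishes, D is block diagonal along the distinct nonzero
    singular values. On the block of sigma_i, where T is the scalar sigma_i^2,
    the equation D T D = T reads X_i^2 = 1.

    It remains to see that the blocks cut out by the given multiplicities s_i
    are those of the given ordered singular value decomposition. The dimension
    s_i of the eigenspace is the number of diagonal entries of Sigma equal to
    sigma_i ([sv_multiplicityE]), and rank W is the number of nonzero ones
    ([rank_svd]); two nonincreasing sequences with the same values and
    multiplicities coincide position by position ([nonincreasing_layout]). *)

(** * Ranks, kernels and diagonal matrices *)

Section DiagonalMatrices.
Variable F : fieldType.

(** The null space of A consists of column vectors, whereas ranks and kernels
    of matrices are row notions; transposing a row basis of kermx A^T carries
    one onto the other. *)
Lemma dim_lker_mulmx m n (A : 'M[F]_(m, n)) :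
  \dim (lker (linfun (mulmx A : 'cV[F]_n -> 'cV[F]_m))) = (n - \rank A)%N.
Proof.
pose B := row_base (kermx A^T).
pose f := (linfun (@trmx F 1 n) \o linfun (mulmxr B))%VF.
have fE u : f u = (u *m B)^T by rewrite /f !lfunE /= !lfunE.
have f_inj : lker f == 0%VS.
  apply/lker0P => u v; rewrite !fE => /trmx_inj.
  exact/row_free_inj/row_base_free.
have -> : lker (linfun (mulmx A : 'cV[F]_n -> 'cV[F]_m)) = limg f.
  apply/vspaceP => x; rewrite memv_ker lfunE /=; apply/eqP/memv_imgP => [Ax0|].
    have /submxP[u xE] : (x^T <= B)%MS.
      by rewrite eq_row_base; apply/sub_kermxP; rewrite -trmx_mul Ax0 trmx0.
    by exists u; rewrite ?memvf // fE -xE trmxK.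
  case=> u _ ->; rewrite fE; apply: trmx_inj.
  rewrite trmx_mul trmxK trmx0; apply/sub_kermxP.
  by rewrite -(eq_row_base (kermx _)) submxMl.
by rewrite limg_dim_eq ?(eqP f_inj) ?capv0 // dimvf /dim /= mul1n mxrank_ker mxrank_tr.
Qed.

Lemma rank_diag_mx m (d : 'rV[F]_m) :
  \rank (diag_mx d) = (\sum_i (d ord0 i != 0%R))%N.
Proof.
elim: m d => [|m IH] d; first by rewrite big_ord0 [diag_mx d]flatmx0 mxrank0.
suff: \rank (diag_mx (row_mx (@lsubmx F 1 1 m d) (@rsubmx F 1 1 m d))) =
    (\sum_(i < 1 + m) (row_mx (@lsubmx F 1 1 m d) (@rsubmx F 1 1 m d) ord0 i != 0%R))%N.
  by rewrite hsubmxK.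
move: (lsubmx _) (rsubmx _) => {d} a b.
rewrite diag_mx_row rank_diag_block_mx IH.
rewrite big_split_ord /= big_ord1 row_mxEl.
congr (_ + _)%N; last by apply: eq_bigr => i _; rewrite row_mxEr.
rewrite rank_rV; congr (nat_of_bool (~~ _)).
apply/eqP/eqP => [/matrixP/(_ ord0 ord0)|d0]; first by rewrite !mxE eqxx mulr1n.
by apply/matrixP => i j; rewrite !ord1 !mxE eqxx mulr1n d0.
Qed.

(** From D T D = T follows (D T)^2 = T^2, so D T commutes with T^2; the (p, q)
    entry of this commutation is the stated identity. *)
Lemma diag_sandwich_support m (t : 'rV[F]_m) (D : 'M[F]_m) :
  D *m diag_mx t *m D = diag_mx t ->
  forall p q, D p q * t ord0 q * (t ord0 q ^+ 2 - t ord0 p ^+ 2) = 0.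
Proof.
move=> DTD p q; set T := diag_mx t in DTD.
have TT : T *m T = D *m T *m (D *m T) by rewrite mulmxA DTD.
have /matrixP/(_ p q) : D *m T *m (T *m T) = T *m T *m (D *m T).
  by rewrite {1}TT mulmxA -TT.
rewrite /T mulmx_diag mul_diag_mx !mul_mx_diag !mxE => E.
by rewrite mulrBr -[X in _ - X]mulrC !expr2 E subrr.
Qed.
End DiagonalMatrices.

(** * Positions of the singular values *)

(** Both d and the concatenation of the constant runs of sigma, padded with q
    zeros, are nonincreasing, and the counting hypotheses make them
    permutations of each other; a sorted arrangement is unique. The length of
    the concatenation is part of the conclusion because it follows from the
    same count. *)
Lemma nonincreasing_layout (R : realDomainType) m t (d : 'I_m -> R) (sigma : 'I_t -> R)
    (s : 'I_t -> nat) q :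
  (forall i j : 'I_m, (i <= j)%N -> d j <= d i) ->
  (forall i j : 'I_t, (i < j)%N -> sigma j < sigma i) ->
  (forall i, 0 < sigma i) ->
  (forall j, d j != 0 -> exists i, sigma i = d j) ->
  (forall i, s i = \sum_j (d j == sigma i))%N ->
  q = (\sum_j (d j == 0%R))%N ->
  (\sum_i s i + q)%N = m /\ forall e : (\sum_i s i + q)%N = m,
    (forall p, d (cast_ord e (lshift q p)) = sigma (tagnat.sig1 p)) /\
    (forall p, d (cast_ord e (rshift _ p)) = 0).
Proof.
move=> d_dec s_dec s_pos d_img sE qE.
have s_inj : injective sigma.
  move=> i j ij; apply: val_inj; case: (ltngtP i j) => // /s_dec;
  by rewrite ij ltxx.
have cntE x : (\sum_j (d j == x) = \sum_i s i * (sigma i == x) + q * (x == 0%R))%N.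
  have [->|x0] := eqVneq x 0.
    rewrite -qE muln1 big1 // => i _.
    by rewrite gt_eqF ?muln0 ?s_pos.
  rewrite muln0 addn0.
  have [i /eqP six|nox] := pickP (fun i => sigma i == x).
    subst x; rewrite (bigD1 i) //= eqxx muln1 -sE big1 ?addn0 // => j ji.
    by rewrite (inj_eq s_inj) (negPf ji) muln0.
  rewrite !big1 // => [i _|j _]; first by rewrite nox muln0.
  apply/eqP; rewrite eqb0; apply/negP => /eqP djx.
  have [|i si] := d_img j; first by rewrite djx.
  by have := nox i; rewrite si djx eqxx.
(* d2 is the concatenation of the runs: position a of the sum carries the
   value of the block that contains it. *)
pose d2 (p : 'I_(\sum_i s i + q)) :=
  match split p with inl a => sigma (tagnat.sig1 a) | inr _ => 0 end.
have d2l a : d2 (lshift q a) = sigma (tagnat.sig1 a).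
  by rewrite /d2 -[lshift q a]/(unsplit (inl a)) unsplitK.
have d2r a : d2 (rshift _ a) = 0.
  by rewrite /d2 -[rshift _ a]/(unsplit (inr a)) unsplitK.
have cnt (k : nat) (f : 'I_k -> R) x : count_mem x (map f (enum 'I_k)) = (\sum_j (f j == x))%N.
  by rewrite count_map -sum1_count big_mkcond big_enum; apply: eq_bigr => j _ /=; case: eqP.
have perm12 : perm_eq (map d2 (enum 'I_(\sum_i s i + q))) (map d (enum 'I_m)).
  apply/allP => x _ /=; rewrite !cnt cntE big_split_ord /=; apply/eqP.
  congr (_ + _)%N.
    under eq_bigr do rewrite d2l.
    rewrite (reindex _ (@tagnat.rank_bij_on _ s)) /=.
    under eq_bigr do rewrite tagnat.rankE tagnat.Rank1K.
    rewrite -(@sig_big_dep _ _ _ _ _ xpredT (fun _ _ => true) (fun i _ => nat_of_bool (sigma i == x))).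
    by apply: eq_bigr => i _; rewrite sum_nat_const card_ord.
  under eq_bigr do rewrite d2r eq_sym.
  by rewrite sum_nat_const card_ord.
have sorted_map_enum (k : nat) (f : 'I_k -> R) :
    (forall i j : 'I_k, (i <= j)%N -> f j <= f i) -> sorted >=%R (map f (enum 'I_k)).
  move=> f_dec; rewrite sorted_map; apply: (@sub_sorted _ (relpre val leq)).
    by move=> i j; apply: f_dec.
  by rewrite -sorted_map val_enum_ord iota_sorted.
have d2_dec (i j : 'I_(\sum_i s i + q)) : (i <= j)%N -> d2 j <= d2 i.
  rewrite -[i]splitK -[j]splitK; case: (split i) => a; case: (split j) => b /=.
  - rewrite !d2l => ab; have := @tagnat.le_sig1 _ _ a b ab.
    rewrite leEord leq_eqVlt => /orP[/eqP/val_inj->//|/s_dec/ltW//].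
  - by rewrite d2l d2r ltW.
  - by move=> /(leq_trans (leq_addr a _)); rewrite leqNgt ltn_ord.
  - by rewrite !d2r.
have e0 : (\sum_i s i + q)%N = m.
  by have := perm_size perm12; rewrite (size_map d2) (size_map d) !size_enum_ord.
have eqs : map d2 (enum 'I_(\sum_i s i + q)) = map d (enum 'I_m).
  apply: (@sorted_eq _ >=%R) perm12; try exact: sorted_map_enum.
  - by move=> a b c /= ab bc; apply: le_trans bc ab.
  - by move=> a b /= ab; apply: le_anti; rewrite andbC.
split=> // e.
have dE p : d (cast_ord e p) = d2 p.
  have lp : (p < size (enum 'I_(\sum_i s i + q)))%N by rewrite size_enum_ord.
  have lp' : (p < size (enum 'I_m))%N by rewrite size_enum_ord -e.
  have := congr1 (fun l => nth 0 l p) eqs.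
  rewrite (nth_map p) // (nth_map (cast_ord e p)) // nth_ord_enum => ->.
  by congr d; apply: val_inj; rewrite /= nth_enum_ord // -e.
by split=> p; rewrite dE.
Qed.

(** * Block diagonal matrices *)

Section BlockDiagonal.
Variables (R : realType) (k : scalar_kind).
Local Notation K := (scalars R k).
Variables (m t : nat) (s : 'I_t -> nat) (q : nat).
Implicit Types (Xb Yb : forall i, 'M[K]_(s i)) (D E : 'M[K]_m).

Lemma block_diagM Xb Yb D E :
  is_block_diag q Xb D -> is_block_diag q Yb E ->
  is_block_diag q (fun i => Xb i *m Yb i) (D *m E).
Proof.
case=> e ->; case=> e' ->; exists e; rewrite (eq_irrelevance e' e).
case: m / e {e' D E}; rewrite !castmx_id mulmx_block !mul0mx !mulmx0 !addr0.
congr block_mx; rewrite /mxdiag mul_mxdiag_mxblock.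
apply: eq_mxblock => i j; case: eqP => [<-|_]; last by rewrite mulmx0.
by rewrite !conform_mx_id.
Qed.

Lemma block_diag_eq Xb Yb D E :
  is_block_diag q Xb D -> is_block_diag q Yb E -> (forall i, Xb i = Yb i) ->
  D = E.
Proof.
case=> e ->; case=> e' -> XY; rewrite (eq_irrelevance e' e).
by congr (castmx _ (block_mx _ _ _ _)); apply: eq_mxdiag.
Qed.

Lemma block_diag_inj Xb Yb D :
  is_block_diag q Xb D -> is_block_diag q Yb D -> forall i, Xb i = Yb i.
Proof.
case=> e ->; case=> e'; rewrite (eq_irrelevance e' e).
case: m / e {e' D}; rewrite !castmx_id => /eq_block_mx[XY _ _ _].
exact/eq_mxdiagP.
Qed.

(** A matrix supported on the positions where a layout c takes equal nonzero
    values: distinct blocks carry distinct values of lambda, and the trailing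
    block carries 0, so nothing survives outside the diagonal blocks. *)
Lemma block_diag_support (e : (\sum_i s i + q)%N = m) D (c : 'I_m -> K)
    (lambda : 'I_t -> K) :
  injective lambda ->
  (forall p, c (cast_ord e (lshift q p)) = lambda (tagnat.sig1 p)) ->
  (forall p, c (cast_ord e (rshift _ p)) = 0) ->
  (forall p p', D p p' != 0 -> c p = c p' /\ c p' != 0) ->
  exists Xb, is_block_diag q Xb D.
Proof.
case: m / e D c => D c l_inj cl cr Dc.
exists (fun i => submxblock (ulsubmx D) i i), erefl; rewrite castmx_id.
rewrite -[LHS]submxK.
have D0 p p' : c p != c p' \/ c p' == 0 -> D p p' = 0.
  move=> cpp'; apply/eqP/negPn/negP => /Dc[cE c0].
  by case: cpp'; rewrite ?cE ?eqxx ?(negPf c0).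
have crE p : c (rshift _ p) = 0 by rewrite -[RHS](cr p) cast_ord_id.
have clE p : c (lshift _ p) = lambda (tagnat.sig1 p).
  by rewrite -[RHS](cl p) cast_ord_id.
congr block_mx.
- rewrite -[LHS]submxblockK; apply: eq_mxblock => i j.
  case: eqVneq => [<-|ij]; first by rewrite conform_mx_id.
  apply/matrixP => a b; rewrite !mxE D0 //; left.
  by rewrite !clE !tagnat.Rank1K (inj_eq l_inj).
- by apply/matrixP => a b; rewrite !mxE D0 //; right; rewrite crE.
- apply/matrixP => a b; rewrite !mxE.
  by apply/eqP/negPn/negP => /Dc[<-]; rewrite crE => /eqP.
- by apply/matrixP => a b; rewrite !mxE D0 //; right; rewrite crE.
Qed.

Lemma block_diag_diag (e : (\sum_i s i + q)%N = m) (c : 'I_m -> K)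
    (lambda : 'I_t -> K) :
  (forall p, c (cast_ord e (lshift q p)) = lambda (tagnat.sig1 p)) ->
  (forall p, c (cast_ord e (rshift _ p)) = 0) ->
  is_block_diag q (fun i => (lambda i)%:M : 'M[K]_(s i)) (diag_mx (\row_p c p)).
Proof.
case: m / e c => c cl cr; exists erefl; rewrite castmx_id.
have crE p : c (rshift _ p) = 0 by rewrite -[RHS](cr p) cast_ord_id.
have clE p : c (lshift _ p) = lambda (tagnat.sig1 p).
  by rewrite -[RHS](cl p) cast_ord_id.
rewrite -[\row_p c p]hsubmxK diag_mx_row; congr block_mx; last first.
  by apply/matrixP => a b; rewrite !mxE crE mul0rn.
have -> : lsubmx (\row_p c p) = \mxrow_i const_mx (lambda i).
  by apply/rowP => a; rewrite !mxE clE.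
by rewrite diag_mxrow; apply: eq_mxdiag => i; rewrite diag_const_mx.
Qed.

End BlockDiagonal.

(** * Adjoints, pseudoinverses and projections *)

Section Adjoint.
Variables (R : realType) (k : scalar_kind).
Local Notation K := (scalars R k).

Lemma adjoint0 m n : adjoint 0 = 0 :> 'M[K]_(n, m).
Proof. by rewrite /adjoint map_mx0 trmx0. Qed.

Lemma adjoint_mul_cancel m n p (A : 'M[K]_(m, n)) (B : 'M[K]_(n, p)) :
  adjoint A *m A *m B = 0 -> A *m B = 0.
Proof.
move=> AAB; apply: adjoint_mul_eq0.
by rewrite adjointM -mulmxA (mulmxA (adjoint A)) AAB mulmx0.
Qed.

Lemma unitaryV n (U : 'M[K]_n) : unitary U -> U *m adjoint U = 1%:M.
Proof. exact: mulmx1C. Qed.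

Lemma pinv_svd m n (U : 'M[K]_m) (S : 'M[K]_(m, n)) (V : 'M[K]_n) :
  unitary U -> unitary V ->
  pinv (U *m S *m adjoint V) = V *m pinv S *m adjoint U.
Proof.
move=> uU uV; apply/esym/pinv_unique; have [h1 h2 h3 h4] := pinvP S.
have AB : U *m S *m adjoint V *m (V *m pinv S *m adjoint U)
    = U *m (S *m pinv S) *m adjoint U.
  by rewrite -!mulmxA (mulmxA (adjoint V)) uV mul1mx.
have BA : V *m pinv S *m adjoint U *m (U *m S *m adjoint V)
    = V *m (pinv S *m S) *m adjoint V.
  by rewrite -!mulmxA (mulmxA (adjoint U)) uU mul1mx.
split; rewrite ?AB ?BA.
- by rewrite -!mulmxA (mulmxA (adjoint U)) uU mul1mx !mulmxA -(mulmxA U) -(mulmxA U) h1.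
- by rewrite -!mulmxA (mulmxA (adjoint V)) uV mul1mx !mulmxA -(mulmxA V) -(mulmxA V) h2.
- by rewrite !(adjointM (U *m _)) (adjointM U) adjointK h3 mulmxA.
- by rewrite !(adjointM (V *m _)) (adjointM V) adjointK h4 mulmxA.
Qed.

Lemma mem_nullspace m n (A : 'M[K]_(m, n)) x : (x \in nullspace A) = (A *m x == 0).
Proof. by rewrite memv_ker lfunE. Qed.

Lemma orthproj_nullspace m n (A : 'M[K]_(m, n)) :
  orthproj (nullspace A) = 1%:M - pinv A *m A.
Proof.
apply/esym/orthproj_unique => x; have [h1 _ _ h4] := pinvP A.
rewrite mulmxBl mul1mx mem_nullspace; split.
  by rewrite mulmxBr !mulmxA h1 subrr.
move=> y; rewrite mem_nullspace opprB addrC subrK => /eqP Ay.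
by rewrite -h4 mulmxA -adjointM -mulmxA Ay mulmx0 adjoint0 mul0mx.
Qed.

Lemma orthproj_nullspace_adjoint m n (A : 'M[K]_(m, n)) :
  orthproj (nullspace (adjoint A)) = 1%:M - A *m pinv A.
Proof.
rewrite orthproj_nullspace; congr (_ - _); have [h1 h2 h3 h4] := pinvP A.
rewrite -h3 adjointM; congr (_ *m _); apply/esym/pinv_unique.
split; rewrite -?adjointM ?mulmxA ?h1 ?h2 //.
- by rewrite h4.
- by rewrite h3.
Qed.

(** * The matrix equation *)

(** Multiplying X W W^* W X Z by X W W^* W on the left and using the equation
    twice turns W^* Z = 0 into W^* W W^* (W X Z) = 0; since A^* A B = 0 forces
    A B = 0, the three leading factors cancel one after the other, down to
    W X Z itself. *)
Lemma solution_kernel m n (W : 'M[K]_(m, n)) (X : 'M[K]_(n, m)) p (Z : 'M[K]_(m, p)) :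
  X *m W *m adjoint W *m W *m X = adjoint W ->
  adjoint W *m Z = 0 -> W *m X *m Z = 0.
Proof.
move=> eqX WZ.
have h : adjoint W *m W *m (adjoint W *m (W *m X *m Z)) = 0.
  have E : adjoint W *m (W *m adjoint W *m W *m X)
      = X *m W *m adjoint W *m W *m adjoint W.
    rewrite -{1}eqX -[LHS]mulmxA -[RHS]/(_ *m adjoint W); congr (_ *m _).
    by rewrite !mulmxA.
  have -> : adjoint W *m W *m (adjoint W *m (W *m X *m Z))
      = adjoint W *m (W *m adjoint W *m W *m X) *m Z by rewrite !mulmxA.
  by rewrite E -mulmxA WZ mulmx0.
have := adjoint_mul_cancel h; rewrite mulmxA -{1}[W]adjointK.
move=> /adjoint_mul_cancel; rewrite -mulmxA mulmxA => /adjoint_mul_cancel.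
by rewrite mulmxA.
Qed.

Lemma solution_adjoint m n (W : 'M[K]_(m, n)) (X : 'M[K]_(n, m)) :
  X *m W *m adjoint W *m W *m X = adjoint W ->
  adjoint X *m adjoint W *m adjoint (adjoint W) *m adjoint W *m adjoint X =
  adjoint (adjoint W).
Proof. by move=> eqX; rewrite -[in RHS]eqX !adjointM !mulmxA. Qed.

(** The equation is invariant under replacing W and X by their adjoints, so this
    is the dual of [solution_kernel]. *)
Lemma solution_cokernel m n (W : 'M[K]_(m, n)) (X : 'M[K]_(n, m)) p (Z : 'M[K]_(p, n)) :
  X *m W *m adjoint W *m W *m X = adjoint W ->
  Z *m adjoint W = 0 -> Z *m X *m W = 0.
Proof.
move=> eqX ZW; have eqX' := solution_adjoint eqX.
have /(solution_kernel eqX') : adjoint (adjoint W) *m adjoint Z = 0.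
  by rewrite -adjointM ZW adjoint0.
by rewrite -!adjointM mulmxA => h; rewrite -[LHS]adjointK h adjoint0.
Qed.

(** Only the term (1 - W^+ W) X W W^+ separates the two sides, and it vanishes
    by [solution_cokernel], because 1 - W^+ W annihilates W^*. *)
Lemma solution_form m n (W : 'M[K]_(m, n)) (X : 'M[K]_(n, m)) :
  X *m W *m adjoint W *m W *m X = adjoint W ->
  X = pinv W *m (W *m X)
      + (1%:M - pinv W *m W) *m X *m (1%:M - W *m pinv W).
Proof.
move=> eqX; have [h1 _ _ h4] := pinvP W.
have /(solution_cokernel eqX) XW0 : (1%:M - pinv W *m W) *m adjoint W = 0.
  by rewrite mulmxBl mul1mx -h4 -adjointM mulmxA h1 subrr.
rewrite mulmxBr mulmx1 [_ *m X *m (W *m _)]mulmxA XW0 mul0mx subr0.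
by rewrite mulmxBl mul1mx mulmxA addrC subrK.
Qed.

(** The Y term disappears under multiplication by W on either side, and
    W^* W W^+ = W^* absorbs the projection left over between the two factors
    M. *)
Lemma form_solution m n (W : 'M[K]_(m, n)) (M : 'M[K]_m) (Y X : 'M[K]_(n, m)) :
  M *m (W *m adjoint W) *m M = W *m adjoint W ->
  X = pinv W *m M + (1%:M - pinv W *m W) *m Y *m (1%:M - W *m pinv W) ->
  X *m W *m adjoint W *m W *m X = adjoint W.
Proof.
move=> eqM XE; have [h1 _ h3 h4] := pinvP W.
have XW : X *m W = pinv W *m M *m W.
  rewrite XE mulmxDl -[X in _ + X]mulmxA (mulmxBl _ _ W) mul1mx h1 subrr.
  by rewrite mulmx0 addr0.
have WX : W *m X = W *m pinv W *m M.
  by rewrite XE mulmxDr 3!mulmxA (mulmxBr W) mulmx1 mulmxA h1 subrr !mul0mx addr0.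
have WWG : adjoint W *m (W *m pinv W) = adjoint W by rewrite -h3 -adjointM h1.
have -> : X *m W *m adjoint W *m W *m X = X *m W *m adjoint W *m (W *m X).
  by rewrite !mulmxA.
rewrite XW WX.
have -> : pinv W *m M *m W *m adjoint W *m (W *m pinv W *m M)
    = pinv W *m (M *m (W *m (adjoint W *m (W *m pinv W))) *m M).
  by rewrite !mulmxA.
by rewrite WWG eqM mulmxA -h4 -adjointM mulmxA h1.
Qed.

End Adjoint.

(** * Singular value decompositions *)

Section SVD.
Variables (R : realType) (k : scalar_kind).
Local Notation K := (scalars R k).

(** The diagonal of S prolonged by zeros to all row indices: as every row of a
    generalized diagonal matrix has at most one nonzero entry, the row sum
    yields it without distinguishing whether i < n. *)
Definition svd_diag m n (S : 'M[R]_(m, n)) (i : 'I_m) : R := \sum_j S i j.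

Lemma real_mx_gram m n (S : 'M[R]_(m, n)) :
  real_mx k S *m adjoint (real_mx k S) = real_mx k (S *m S^T).
Proof.
rewrite /real_mx map_mxM; congr (_ *m _).
apply/matrixP => i j; rewrite !mxE.
by case: k => //=; rewrite oppr0.
Qed.

Section Diag.
Variables (m n : nat) (S : 'M[R]_(m, n)).
Hypothesis S_diag : forall (i : 'I_m) (j : 'I_n), i != j :> nat -> S i j = 0.

Lemma svd_diagE (i : 'I_m) (j : 'I_n) : i = j :> nat -> svd_diag S i = S i j.
Proof.
move=> ij; rewrite /svd_diag (bigD1 j) //= big1 ?addr0 // => l lj.
by rewrite S_diag // ij eq_sym.
Qed.

Lemma svd_diag_neq0 (i : 'I_m) :
  svd_diag S i != 0 -> exists2 j : 'I_n, i = j :> nat & svd_diag S i = S i j.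
Proof.
move=> di; have [ni|ni] := ltnP i n; first by exists (Ordinal ni) => //; apply: svd_diagE.
case/eqP: di; apply: big1 => l _; rewrite S_diag //.
by rewrite gtn_eqF // (leq_trans (ltn_ord l)).
Qed.

Lemma svd_gram : S *m S^T = diag_mx (\row_i (svd_diag S i ^+ 2)).
Proof.
apply/matrixP => i i'; rewrite !mxE.
have [<-{i'}|ii'] := eqVneq i i'; last first.
  rewrite mulr0n big1 // => l _; rewrite mxE.
  have [il|il] := eqVneq (i : nat) l; last by rewrite (S_diag il) mul0r.
  by rewrite (S_diag (i := i')) ?mulr0 // -il eq_sym.
rewrite mulr1n; have [d0|/svd_diag_neq0[j ij dj]] := eqVneq (svd_diag S i) 0.
  rewrite d0 expr0n /= big1 // => l _; rewrite mxE.
  have [il|/S_diag->] := eqVneq (i : nat) l; last by rewrite mul0r.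
  by rewrite -(svd_diagE il) d0 mul0r.
rewrite dj (bigD1 j) //= mxE -expr2 big1 ?addr0 // => l lj.
by rewrite S_diag ?mul0r // ij eq_sym.
Qed.
End Diag.

Lemma rank_gram m n (W : 'M[K]_(m, n)) : \rank (W *m adjoint W) = \rank W.
Proof.
have ker_gram p q (A : 'M[K]_(p, q)) : (kermx (A *m adjoint A) <= kermx A)%MS.
  apply/sub_kermxP; set Z := kermx _; rewrite -[LHS]adjointK adjointM.
  rewrite [adjoint A *m _]adjoint_mul_cancel ?adjoint0 //.
  by rewrite adjointK -[A *m _]adjointK adjointM adjointK -adjointM mulmx_ker adjoint0.
have := mxrankS (ker_gram m n W); rewrite !mxrank_ker.
have := rank_leq_row W; have := mxrankM_maxl W (adjoint W).
by move=> WW Wm; rewrite leq_sub2lE // => WW'; apply/eqP; rewrite eqn_leq WW.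
Qed.

Section Gram.
Variables (m n : nat) (W : 'M[K]_(m, n)).
Variables (U : 'M[K]_m) (S : 'M[R]_(m, n)) (V : 'M[K]_n).
Hypothesis svdW : is_svd W U S V.

Lemma gram_svd :
  W *m adjoint W
  = U *m diag_mx (\row_i of_real k (svd_diag S i ^+ 2)) *m adjoint U.
Proof.
have [uU uV -> [S_diag _ _]] := svdW.
have -> : diag_mx (\row_i of_real k (svd_diag S i ^+ 2)) = real_mx k (S *m S^T).
  rewrite (svd_gram S_diag); apply/matrixP => i j; rewrite !mxE.
  by rewrite rmorphMn.
rewrite -real_mx_gram !adjointM adjointK -!mulmxA.
by rewrite (mulmxA (adjoint V)) uV mul1mx.
Qed.

(** The Gram matrix is unitarily diagonalizable with the squares of the diagonal
    of S as eigenvalues. The case a = 0 gives the rank of W, and positive a give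
    the multiplicities. *)
Lemma rank_gram_shift (a : R) :
  \rank (W *m adjoint W - (of_real k a)%:M)
  = (\sum_j (svd_diag S j ^+ 2 != a))%N.
Proof.
have [uU _ _ _] := svdW; have UU := unitaryV uU.
have uU1 : U \in unitmx by case: (mulmx1_unit UU).
have uU2 : adjoint U \in unitmx by case: (mulmx1_unit UU).
have -> : W *m adjoint W - (of_real k a)%:M =
    U *m diag_mx (\row_i of_real k (svd_diag S i ^+ 2 - a)) *m adjoint U.
  have -> : diag_mx (\row_i of_real k (svd_diag S i ^+ 2 - a))
      = diag_mx (\row_i of_real k (svd_diag S i ^+ 2)) - (of_real k a)%:M.
    by apply/matrixP => i j; rewrite !mxE rmorphB mulrnBl.
  rewrite mulmxBr mulmxBl -gram_svd; congr (_ - _).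
  by rewrite mul_mx_scalar -scalemxAl UU scalemx1.
rewrite mxrankMfree ?row_free_unit // -mxrank_tr trmx_mul mxrankMfree; last first.
  by rewrite row_free_unit unitmx_tr.
rewrite mxrank_tr rank_diag_mx; apply: eq_bigr => j _.
by rewrite mxE fmorph_eq0 subr_eq0.
Qed.

Lemma rank_svd : \rank W = (\sum_j (svd_diag S j != 0%R))%N.
Proof.
have := rank_gram_shift 0; rewrite rmorph0 [_%:M]raddf0 subr0 rank_gram => ->.
by apply: eq_bigr => j _; rewrite sqrf_eq0.
Qed.

Lemma svd_diag_ge0 j : 0 <= svd_diag S j.
Proof.
have [_ _ _ [S_diag S_ge0 _]] := svdW.
by apply: sumr_ge0 => l _; have [/S_ge0//|/S_diag->] := eqVneq (j : nat) l.
Qed.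

Lemma svd_diag_anti (i j : 'I_m) : (i <= j)%N -> svd_diag S j <= svd_diag S i.
Proof.
have [_ _ _ [S_diag _ S_dec]] := svdW => ij.
have [->|/(svd_diag_neq0 S_diag)[j' jj' ->]] := eqVneq (svd_diag S j) 0.
  exact: svd_diag_ge0.
have ni : (i < n)%N by rewrite (leq_ltn_trans ij) // jj'.
rewrite (svd_diagE S_diag (j := Ordinal ni)) //.
exact: S_dec.
Qed.

Lemma svd_diag_singular j : svd_diag S j != 0 -> singular_value W (svd_diag S j).
Proof.
have [_ _ _ [S_diag _ _]] := svdW.
move=> /(svd_diag_neq0 S_diag)[j' jj' ->]; exists U, S, V; split=> //.
by exists j, j'.
Qed.

Lemma sv_multiplicityE (x : R) : 0 <= x ->
  sv_multiplicity W x = (\sum_j (svd_diag S j == x))%N.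
Proof.
move=> x_ge0; rewrite /sv_multiplicity /passmx.leigenspace.
set a := of_real k _; set A := W *m _.
have -> : linfun (mulmx A : 'cV[K]_m -> 'cV[K]_m) - a *: \1%VF
    = linfun (mulmx (A - a%:M) : 'cV[K]_m -> 'cV[K]_m).
  apply/lfunP => v; rewrite add_lfunE opp_lfunE scale_lfunE id_lfunE !lfunE /= mulmxBl.
  by rewrite mul_scalar_mx.
rewrite dim_lker_mulmx rank_gram_shift.
have {1}-> : m = (\sum_(j < m) 1)%N by rewrite sum1_card card_ord.
rewrite -sumnB => [|j _]; last exact: leq_b1.
apply: eq_bigr => j _.
by rewrite eqrXn2 ?svd_diag_ge0 //; case: eqP.
Qed.
End Gram.

Lemma singular_value_ge0 m n (W : 'M[K]_(m, n)) x : singular_value W x -> 0 <= x.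
Proof.
by case=> U [S [V [[_ _ _ [_ S_ge0 _]] [i [j [ij <-]]]]]]; apply: S_ge0.
Qed.

End SVD.

(** * Description of the solutions *)

Theorem theorem5p1 (R : realType) (k : scalar_kind) (m n r : nat)
  (W : 'M[scalars R k]_(m, n)) (hr : \rank W = r)
  (U : 'M[scalars R k]_m) (Sigma : 'M[R]_(m, n)) (V : 'M[scalars R k]_n)
  (hsvd : is_svd W U Sigma V)
  (t : nat) (sigma : 'I_t -> R)
  (sigma_decr : forall i j : 'I_t, (i < j)%N -> sigma j < sigma i)
  (sigma_sv : forall x : R,
     (exists i : 'I_t, sigma i = x) <-> (singular_value W x /\ x <> 0))
  (s : 'I_t -> nat) (hs : forall i : 'I_t, s i = sv_multiplicity W (sigma i))
  (X : 'M[scalars R k]_(n, m)) :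
  X *m W *m adjoint W *m W *m X = adjoint W <->
  exists (Xb : forall i : 'I_t, 'M[scalars R k]_(s i))
         (D : 'M[scalars R k]_m) (Y : 'M[scalars R k]_(n, m)),
    [/\ is_block_diag (m - r) Xb D,
        forall i : 'I_t, Xb i *m Xb i = 1%:M &
        X = V *m pinv (real_mx k Sigma) *m D *m adjoint U
            + orthproj (nullspace W) *m Y *m orthproj (nullspace (adjoint W))].
Proof.
set d := svd_diag Sigma.
have sigma_gt0 i : 0 < sigma i.
  have [/singular_value_ge0 s0 /eqP sn0] := (sigma_sv (sigma i)).1 (ex_intro _ i erefl).
  by rewrite lt_neqAle eq_sym sn0.
have sE i : s i = (\sum_j (d j == sigma i))%N.
  by rewrite hs (sv_multiplicityE hsvd) ?ltW.
have qE : (m - r)%N = (\sum_j (d j == 0%R))%N.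
  rewrite -hr (rank_svd hsvd) -/d.
  have {1}-> : m = (\sum_(j < m) 1)%N by rewrite sum1_card card_ord.
  rewrite -sumnB => [|j _]; last exact: leq_b1.
  by apply: eq_bigr => j _; case: eqP.
have d_img j : d j != 0 -> exists i, sigma i = d j.
  by move=> dj; apply/sigma_sv; split; [exact: svd_diag_singular hsvd _ dj | exact/eqP].
have [e /(_ e)[dl dr]] := nonincreasing_layout (svd_diag_anti hsvd) sigma_decr sigma_gt0 d_img sE qE.
pose lambda i := of_real k (sigma i ^+ 2).
pose c j := of_real k (d j ^+ 2).
have cl p : c (cast_ord e (lshift _ p)) = lambda (tagnat.sig1 p) by rewrite /c /d dl.
have cr p : c (cast_ord e (rshift _ p)) = 0 by rewrite /c /d dr expr0n rmorph0.
have bT := block_diag_diag cl cr; set T := diag_mx _ in bT.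
have lambda_neq0 i : lambda i != 0 by rewrite fmorph_eq0 sqrf_eq0 gt_eqF.
have lambda_inj : injective lambda.
  move=> i j /fmorph_inj/eqP; rewrite eqrXn2 ?ltW // => /eqP sij.
  by apply: val_inj; case: (ltngtP i j) => // /sigma_decr; rewrite sij ltxx.
have gramE : W *m adjoint W = U *m T *m adjoint U := gram_svd hsvd.
have [uU uV WE _] := hsvd; have UU := unitaryV uU.
have pinvE : pinv W = V *m pinv (real_mx k Sigma) *m adjoint U by rewrite WE pinv_svd.
have conjT (D : 'M_m) : D *m T *m D = T ->
    (U *m D *m adjoint U) *m (W *m adjoint W) *m (U *m D *m adjoint U) = W *m adjoint W.
  move=> DTD; rewrite gramE -[T in RHS]DTD -!mulmxA.
  by rewrite !(mulmxA (adjoint U) U) uU !mul1mx.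
rewrite orthproj_nullspace orthproj_nullspace_adjoint.
split=> [eqX | [Xb [D [Y [bD Xb2 XE]]]]]; last first.
  apply: (@form_solution _ _ _ _ W (U *m D *m adjoint U) Y).
    apply: conjT; apply: block_diag_eq (block_diagM (block_diagM bD bT) bD) bT _.
    by move=> i; rewrite mul_mx_scalar -scalemxAl Xb2 scalemx1.
  rewrite {1}XE pinvE; congr (_ + _).
  by rewrite -!mulmxA (mulmxA (adjoint U) U) uU mul1mx.
pose D := adjoint U *m (W *m X) *m U.
have ME : W *m X = U *m D *m adjoint U.
  by rewrite /D !mulmxA UU mul1mx -!mulmxA UU mulmx1.
have TE : T = adjoint U *m (W *m adjoint W) *m U.
  by rewrite gramE !mulmxA uU mul1mx -!mulmxA uU mulmx1.
have DTD : D *m T *m D = T.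
  rewrite /D TE -!mulmxA !(mulmxA U (adjoint U)) UU !mul1mx; congr (_ *m _).
  rewrite !(mulmxA _ _ U); congr (_ *m _).
  by rewrite -[in RHS]eqX !mulmxA.
(* If T kills the basis vector of index p', then W^* kills the corresponding
   left singular vector, and so does M. *)
have D0 p p' : c p' = 0 -> D p p' = 0.
  move=> cp'.
  have Tp' : T *m delta_mx p' (0 : 'I_1) = 0.
    rewrite mul_diag_mx; apply/matrixP => i j; rewrite !mxE.
    by case: eqVneq => [->|_] /=; rewrite ?cp' ?mul0r ?mulr0.
  have /(solution_kernel eqX) : adjoint W *m (U *m delta_mx p' (0 : 'I_1)) = 0.
    apply: adjoint_mul_cancel; rewrite adjointK gramE -!mulmxA.
    by rewrite (mulmxA (adjoint U) U) uU mul1mx Tp' !mulmx0.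
  move=> /(congr1 (mulmx (adjoint U))); rewrite mulmx0 !mulmxA -(mulmxA (adjoint U) W).
  by move/matrixP/(_ p ord0); rewrite -colE !mxE.
move: D ME DTD D0 => D ME DTD D0.
have D_supp p p' : D p p' != 0 -> c p = c p' /\ c p' != 0.
  move=> Dpp'; have cp' : c p' != 0 by apply: contra_neq Dpp'; exact: D0.
  split=> //; have /eqP := diag_sandwich_support DTD p p'; rewrite !mxE.
  rewrite mulf_eq0 mulf_eq0 (negPf Dpp') (negPf cp') /= subr_eq0 eq_sym.
  rewrite -!rmorphXn (inj_eq (fmorph_inj _)) eqrXn2 ?sqr_ge0 //.
  by move/eqP => dd; rewrite /c dd.
have [Xb bD] := block_diag_support lambda_inj cl cr D_supp.
(* X itself can serve as the free parameter Y. *)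
exists Xb, D, X; split=> //.
  move=> i; have bDTD := block_diagM (block_diagM bD bT) bD.
  rewrite DTD in bDTD.
  have := block_diag_inj bDTD bT i; rewrite mul_mx_scalar -scalemxAl.
  by rewrite -[RHS]scalemx1; apply: (scalerI (lambda_neq0 i)).
rewrite {1}(solution_form eqX); congr (_ + _).
by rewrite ME pinvE -!mulmxA (mulmxA (adjoint U) U) uU mul1mx.
Qed.
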